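(* Let $\mathcal{H}$ be a real Hilbert space, let $\mathcal{Y} \subset \mathcal{H}$ be a set with non-empty interior, let $y$ be a point of the interior of $\mathcal{Y}$, and let $f: \mathcal{Y} \to \mathcal{H}$ be a proximity operator (of some function $\varphi:\mathcal{H}\to\mathbb{R}\cup\{+\infty\}$). If $f$ is $C^1$ in a neighborhood of $y$, then $Df(y)$ is symmetric positive semi-definite.
   Context: For $\varphi: \mathcal{H} \to \mathbb{R}\cup\{+\infty\}$ and $y \in \mathcal{H}$, $\mathrm{prox}_\varphi(y) := \arg\min_{x \in \mathcal{H}} \{\tfrac12\|y-x\|^2 + \varphi(x)\}$ is the set of global minimizers (a minimizer is required to have finite objective value, so the set is empty if $\varphi\equiv+\infty$). A function $f:\mathcal{Y}\to\mathcal{H}$ is a proximity operator of $\varphi$ if $f(y) \in \mathrm{prox}_\varphi(y)$ for each $y\in\mathcal{Y}$. Differentiability is in the Fréchet sense; $Df(y)$ is the differential of $f$ at $y$. A continuous linear operator $L:\mathcal{H}\to\mathcal{H}$ is symmetric if $\langle x,Ly\rangle=\langle Lx,y\rangle$ for all $x,y\in\mathcal{H}$; a symmetric $L$ is positive semi-definite if $\langle x,Lx\rangle\geq 0$ for all $x\in\mathcal{H}$. *)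

(* Defs.v *)
From HB Require Import structures.
From mathcomp Require Import all_boot all_order all_algebra.
From mathcomp Require Import all_classical all_reals all_analysis.

Set Implicit Arguments.
Unset Strict Implicit.
Unset Printing Implicit Defensive.
Import Order.TTheory GRing.Theory Num.Theory.
Import numFieldNormedType.Exports.
Local Open Scope classical_set_scope.
Local Open Scope ring_scope.

(* A real Hilbert space is a complete normed module [H] over [R] together with
   a positive definite symmetric bilinear form inducing its norm. *)
Definition induces_norm (R : realType) (H : normedModType R)
    (dot : {dot H for idfun}) : Prop :=
  forall x : H, dot x x = `|x| ^+ 2.

Definition prox_objective (R : realType) (H : normedModType R)
    (phi : H -> \bar R) (y x : H) : \bar R :=
  ((2^-1 * `|y - x| ^+ 2)%:E + phi x)%E.

Definition prox (R : realType) (H : normedModType R)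
    (phi : H -> \bar R) (y : H) : set H :=
  [set x | prox_objective phi y x \is a fin_num /\
           forall z : H, (prox_objective phi y x <= prox_objective phi y z)%E].

(* A function [Y -> H] is represented by a total function [H -> H] whose values
   outside [Y] are irrelevant. *)
Definition proximity_operator (R : realType) (H : normedModType R)
    (phi : H -> \bar R) (Y : set H) (f : H -> H) : Prop :=
  forall y : H, Y y -> prox phi y (f y).

(* Extended-real valued, so that an unbounded map has norm [+oo] rather than a
   default value. *)
Definition operator_norm (R : realType) (H : normedModType R) (L : H -> H) :
    \bar R :=
  ereal_sup [set (`|L h|)%:E | h in [set h : H | `|h| <= 1]].

(* Differentiability is in the sense of Fréchet, and the differential is
   continuous from [U] to the bounded operators with the operator norm. *)
Definition C1_on (R : realType) (H : normedModType R)
    (U : set H) (f : H -> H) : Prop :=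
  (forall x : H, U x -> differentiable f x) /\
  (forall x : H, U x ->
     operator_norm ('d f z \- 'd f x) @[z --> within U (nbhs x)] --> 0%E).

(* The neighborhood is taken inside the domain [Y] of [f], so that the values
   of [f] outside [Y] play no role. *)
Definition C1_near (R : realType) (H : normedModType R)
    (Y : set H) (f : H -> H) (y : H) : Prop :=
  exists U : set H, [/\ open U, U y, U `<=` Y & C1_on U f].

Definition symmetric_operator (R : realType) (H : normedModType R)
    (dot : {dot H for idfun}) (L : {linear H -> H}) : Prop :=
  forall x y : H, dot x (L y) = dot (L x) y.

Definition positive_semidefinite (R : realType) (H : normedModType R)
    (dot : {dot H for idfun}) (L : {linear H -> H}) : Prop :=
  forall x : H, 0 <= dot x (L x).

(* Main.v *)
(* The prox f is a selection of the subdifferential of a potential psi, i.e.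
   psi b - psi a >= <f a, b - a>.  Along any closed polygon near y the
   potential telescopes away, and this inequality passes to the difference
   quotients of f, hence to L = Df(y): the sum of <L x_i, x_(i+1) - x_i> over
   a closed polygon is nonpositive.  The polygon 0, x, 0 gives positivity.  For
   the triangle 0, u, v with sides cut into n pieces, the sum is a Riemann sum
   of the circulation of L, which equals (<L u, v> - <L v, u>) / 2 up to O(1/n);
   exchanging u and v gives symmetry. *)
Require Import Defs.
From HB Require Import structures.
From mathcomp Require Import all_boot all_order all_algebra.
From mathcomp Require Import all_classical all_reals all_analysis.
From mathcomp Require Import ring lra.
Set Implicit Arguments.
Unset Strict Implicit.
Unset Printing Implicit Defensive.
Import Order.TTheory GRing.Theory Num.Theory.
Import numFieldNormedType.Exports.
Local Open Scope classical_set_scope.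
Local Open Scope ring_scope.

Section ProximityPotential.
Context (R : realType) (H : normedModType R) (dot : {dot H for idfun}).
Hypothesis Hdot : induces_norm dot.

Lemma dotC (x y : H) : dot x y = dot y x.
Proof. by rewrite hermC expr0 mul1r. Qed.

Lemma dotZr (x y : H) (a : R) : dot x (a *: y) = a * dot x y.
Proof. by rewrite linearZr_LR. Qed.

(** Polarization writes the inner product through norms, whose continuity is known. *)
Lemma cvg_dotl (T : Type) (F : set_system T) {FF : Filter F} (g : T -> H)
    (l c : H) : g @ F --> l -> dot (g t) c @[t --> F] --> dot l c.
Proof.
move=> gl.
have polar x : dot x c = 4^-1 * (`|x + c| ^+ 2 - `|x - c| ^+ 2).
  rewrite -!Hdot !linearDl !linearDr /= !linearNl !linearNr /= (dotC c x).
  by field.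
rewrite (_ : (fun t => _) =
  fun t => 4^-1 * (`|g t + c| ^+ 2 - `|g t - c| ^+ 2)); last first.
  by apply/funext => t; exact: polar.
rewrite polar; apply: cvgMr; apply: cvgB; rewrite !expr2.
  by apply: cvgM; apply: cvg_norm; apply: cvgD => //; exact: cvg_cst.
by apply: cvgM; apply: cvg_norm; apply: cvgB => //; exact: cvg_cst.
Qed.

(** On [Y] this is half the squared norm of [y] minus the Moreau envelope of [phi] at [y]. *)
Definition prox_potential (phi : H -> \bar R) (f : H -> H) (y : H) : R :=
  dot (f y) y - 2^-1 * dot (f y) (f y) - fine (phi (f y)).

(** The minimizer [f b] at [b] is tested against the competitor [f a]; after expanding the squares,
    the terms in [dot b b] cancel. *)
Lemma prox_potential_subgradient (phi : H -> \bar R) (Y : set H) (f : H -> H)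
    (a b : H) : proximity_operator phi Y f -> Y a -> Y b ->
  dot (f a) (b - a) <= prox_potential phi f b - prox_potential phi f a.
Proof.
move=> Hf /Hf[fina _] /Hf[finb minb]; have := minb (f a).
(* A finite objective forces [phi] to be finite there, so [fine] returns its true value. *)
have {}fina : phi (f a) \is a fin_num by rewrite fin_numD in fina; case/andP: fina.
have {}finb : phi (f b) \is a fin_num by rewrite fin_numD in finb; case/andP: finb.
rewrite /prox_objective /prox_potential.
rewrite -(fineK fina) -(fineK finb) -!EFinD lee_fin -!Hdot /=.
rewrite !linearDl !linearDr /= !linearNl !linearNr /= opprK.
rewrite (dotC b (f a)) (dotC b (f b)); lra.
Qed.

(** Left-endpoint Riemann sum, with [n] equal steps, of the line integral of [F] along the segment
    from [a] to [b]. *)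
Definition chord_sum (F : H -> H) (n : nat) (a b : H) : R :=
  \sum_(i < n) dot (F (a + (i%:R / n%:R) *: (b - a))) (n%:R^-1 *: (b - a)).

Lemma chord_sum_le (F : H -> H) (q : H -> R) (n : nat) (a b : H) :
    (0 < n)%N ->
    (forall i j : nat, (i <= n)%N -> (j <= n)%N ->
      let x := a + (i%:R / n%:R) *: (b - a) in
      let z := a + (j%:R / n%:R) *: (b - a) in
      dot (F x) (z - x) <= q z - q x) ->
  chord_sum F n a b <= q b - q a.
Proof.
move=> n0 Fq; have n0R : n%:R != 0 :> R by rewrite pnatr_eq0 -lt0n.
pose u i := q (a + (i%:R / n%:R) *: (b - a)).
have -> : q b - q a = \sum_(0 <= i < n) (u i.+1 - u i).
  by rewrite telescope_sumr // /u divff // scale1r mul0r scale0r addr0 subrKC.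
rewrite big_mkord; apply: ler_sum => i _.
have := Fq i i.+1 (ltnW (ltn_ord i)) (ltn_ord i).
rewrite /= -/(u i) -/(u i.+1); apply: le_trans.
rewrite opprD addrACA subrr add0r -scalerBl -mulrBl -addn1 natrD.
by rewrite [i%:R + 1]addrC addrK mul1r.
Qed.

(** The terms are affine in [i], and the indices below [n] sum to n(n-1)/2. The correction [n%:R^-1]
    is the gap between the left-endpoint sum and the integral. *)
Lemma chord_sum_linear (L : {linear H -> H}) (n : nat) (a b : H) :
  (0 < n)%N ->
  chord_sum L n a b =
  dot (L a) (b - a) + 2^-1 * (1 - n%:R^-1) * dot (L (b - a)) (b - a).
Proof.
move=> n0; have n0R : n%:R != 0 :> R by rewrite pnatr_eq0 -lt0n.
rewrite /chord_sum; set d := b - a; set p := dot (L a) d; set s := dot (L d) d.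
under eq_bigr => i _.
  rewrite (linearD L) (linearZ_LR L) linearDl linearZl_LR /= !dotZr -/p -/s.
  over.
(* The number of terms [m] varies in the induction while the mesh 1/n stays fixed. *)
have sumE m : \sum_(i < m) (n%:R^-1 * p + i%:R / n%:R * (n%:R^-1 * s)) =
    m%:R / n%:R * p + 2^-1 * (m%:R * (m%:R - 1)) / (n%:R * n%:R) * s.
  elim: m => [|m IHm]; first by rewrite big_ord0; field.
  by rewrite big_ord_recr /= IHm -addn1 natrD; field.
by rewrite sumE; field.
Qed.

Lemma cvg_chord_sum (T : Type) (F : set_system T) {FF : Filter F}
    (g : T -> H -> H) (L : H -> H) (n : nat) (a b : H) :
    (forall x : H, g t x @[t --> F] --> L x) ->
  chord_sum (g t) n a b @[t --> F] --> chord_sum L n a b.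
Proof.
move=> gL; apply: cvg_big => [|i _]; first exact: add_continuous.
by apply: cvg_dotl; exact: gL.
Qed.

Definition difference_quotient (f : H -> H) (y : H) (t : R) (x : H) : H :=
  t^-1 *: (f (y + t *: x) - f y).

Lemma cvg_difference_quotient (f : H -> H) (y x : H) :
  differentiable f y -> difference_quotient f y t x @[t --> 0^'] --> 'd f y x.
Proof.
move=> df; rewrite -deriveE //.
rewrite (_ : (fun t => _) =
  fun t : R => t^-1 *: ((f \o shift y) (t *: x) - f y)).
  exact: diff_derivable.
by apply/funext => t; rewrite /difference_quotient /= [y + _]addrC.
Qed.

Section SubgradientSelection.
Variables (Y : set H) (f : H -> H) (psi : H -> R).
Hypothesis subgrad : forall a b : H, Y a -> Y b ->
  dot (f a) (b - a) <= psi b - psi a.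

(** Up to a constant, [q] is [psi] near [y] minus its linear part [dot (f y)], rescaled to second
    order. *)
Lemma difference_quotient_subgradient (y : H) (t : R) (a b : H) : t != 0 ->
    Y (y + t *: a) -> Y (y + t *: b) ->
  let q x := t^-1 * (t^-1 * psi (y + t *: x) - dot (f y) x) in
  dot (difference_quotient f y t a) (b - a) <= q b - q a.
Proof.
move=> t0 Ya Yb /=.
have := subgrad Ya Yb; rewrite opprD addrACA subrr add0r -scalerBr dotZr => le_psi.
have -> : dot (difference_quotient f y t a) (b - a) =
    t^-1 * t^-1 * (t * dot (f (y + t *: a)) (b - a)) - t^-1 * dot (f y) (b - a).
  rewrite linearZl_LR /= linearBl /=; field; exact: t0.
(* The factor is a square, so the inequality keeps its direction for [t] of either sign. *)
have := ler_wpM2l (sqr_ge0 t^-1) le_psi.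
rewrite expr2 [dot (f y) _]linearBr /=; lra.
Qed.

Lemma triangle_chord_sum_le0 (y a b c : H) (n : nat) : (0 < n)%N ->
    Y° y -> differentiable f y ->
  chord_sum ('d f y) n a b + chord_sum ('d f y) n b c
    + chord_sum ('d f y) n c a <= 0.
Proof.
move=> n0 Yy df; pose g := difference_quotient f y.
have cvgS u v : chord_sum (g t) n u v @[t --> 0^'] --> chord_sum ('d f y) n u v.
  by apply: cvg_chord_sum => x; exact: cvg_difference_quotient.
apply: cvgr_to_le (cvgD (cvgD (cvgS a b) (cvgS b c)) (cvgS c a)) _.
have [r /= r0 ballY] := (@nbhs_ballP _ _ _ _).1 Yy.
(* One bound on the whole segment puts all its subdivision points, scaled by a small [t], in a ball
   around [y] inside [Y]. *)
have near_Y u v : \forall t \near (0 : R)^', forall i : nat, (i <= n)%N ->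
    Y (y + t *: (u + (i%:R / n%:R) *: (v - u))).
  (* The added 1 keeps the bound positive when [u] and [v] both vanish. *)
  have M0 : 0 < `|u| + `|v - u| + 1 by rewrite ltr_wpDl // addr_ge0.
  near=> t => i le_in; apply: ballY; rewrite -ball_normE /= opprD addNKr normrN.
  rewrite normrZ; apply: (@le_lt_trans _ _ (`|t| * (`|u| + `|v - u| + 1))).
    rewrite ler_wpM2l // (le_trans (ler_normD _ _)) // -addrA lerD2l normrZ.
    rewrite -[leLHS]addr0 lerD // ler_piMl // ger0_norm ?divr_ge0 //.
    by rewrite ler_pdivrMr ?ltr0n // mul1r ler_nat.
  rewrite -ltr_pdivlMr //; near: t; apply: dnbhs0_lt; exact: divr_gt0.
near=> t.
have t0 : t != 0 by near: t; exact: nbhs_dnbhs_neq.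
pose q x := t^-1 * (t^-1 * psi (y + t *: x) - dot (f y) x).
have chordS u v : (forall i : nat, (i <= n)%N ->
    Y (y + t *: (u + (i%:R / n%:R) *: (v - u)))) ->
    chord_sum (g t) n u v <= q v - q u.
  move=> Yuv; apply: chord_sum_le => // i j le_in le_jn /=.
  by apply: difference_quotient_subgradient => //; exact: Yuv.
have ab : chord_sum (g t) n a b <= q b - q a by apply: chordS; near: t.
have bc : chord_sum (g t) n b c <= q c - q b by apply: chordS; near: t.
have ca : chord_sum (g t) n c a <= q a - q c by apply: chordS; near: t.
by rewrite !fctE; lra.
Unshelve. all: by end_near. Qed.

Lemma diff_subgradient_selection_psd (y : H) : Y° y -> differentiable f y ->
  positive_semidefinite dot ('d f y).
Proof.
move=> Yy df x; have := triangle_chord_sum_le0 0 x 0 (ltn0Sn 0) Yy df.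
(* With a single piece per side, the factor 1 - 1/n vanishes and only the endpoint terms remain. *)
rewrite !chord_sum_linear // invr1 subrr mulr0 !mul0r !addr0 linear0 subr0 sub0r.
by rewrite !linear0l addr0 add0r linearNr oppr_le0 dotC.
Qed.

Lemma diff_subgradient_selection_symmetric (y : H) : Y° y ->
  differentiable f y -> symmetric_operator dot ('d f y).
Proof.
move=> Yy df; pose beta u v := dot ('d f y u) v.
have le_beta u v : beta u v <= beta v u.
  (* Coefficient of 1/n in the triangle sum: half the total of [beta d d] over the three sides [d].
     Here n = [m.+1], so that 1/n is [harmonic m]. *)
  pose err := 2^-1 * (beta u u + beta (v - u) (v - u) + beta v v).
  have le_err m : 2^-1 * (beta u v - beta v u) - err * harmonic m <= 0.
    have := triangle_chord_sum_le0 0 u v (ltn0Sn m) Yy df.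
    rewrite !chord_sum_linear // linear0 linear0l subr0 sub0r /err /harmonic /=.
    rewrite /beta (linearN ('d f y)) (linearB ('d f y)).
    rewrite !(linearNl dot, linearBl dot, linearNr dot, linearBr dot) /=.
    set k : R := m.+1%:R^-1; lra.
  have : 2^-1 * (beta u v - beta v u) <= 0.
    have cvg_err : 2^-1 * (beta u v - beta v u) - err * harmonic m @[m --> \oo]
        --> 2^-1 * (beta u v - beta v u) - err * 0.
      by apply: cvgB; [exact: cvg_cst | apply: cvgMr; exact: cvg_harmonic].
    rewrite mulr0 subr0 in cvg_err.
    by apply: (cvgr_to_le cvg_err); apply: nearW.
  lra.
by move=> u v; rewrite dotC; apply/eqP; rewrite eq_le !le_beta.
Qed.

End SubgradientSelection.

End ProximityPotential.

Theorem corollary2 (R : realType) (H : completeNormedModType R)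
    (dot : {dot H for idfun}) (Hdot : induces_norm dot)
    (Y : set H) (HY : Y° !=set0) (y : H) (Hy : Y° y)
    (f : H -> H) (phi : H -> \bar R) (Hphi : forall x : H, phi x != -oo%E)
    (Hf : proximity_operator phi Y f) (HC1 : C1_near Y f y) :
  symmetric_operator dot ('d f y) /\ positive_semidefinite dot ('d f y).
Proof.
have [U [_ Uy _ [dfU _]]] := HC1.
have subgrad a b := @prox_potential_subgradient _ _ dot Hdot phi Y f a b Hf.
split; first exact: (diff_subgradient_selection_symmetric Hdot subgrad Hy (dfU y Uy)).
exact: (diff_subgradient_selection_psd Hdot subgrad Hy (dfU y Uy)).
Qed.
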